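(* The explicit two-step variable step-size linear multistep method $$x_{n+2}-(5-3w_{n+1})x_{n+1}+(4-3w_{n+1})x_n = h_{n+1}\left(\frac{w_{n+1}-1}{w_{n+1}}\right)\Big((20-12w_{n+1})\,g(x_{n+1})-(16-12w_{n+1})\,g(x_{n})\Big)$$ for $\dot x = g(x)$ is consistent of order $1$.
   Context: A grid is a sequence $t_0<t_1<t_2<\cdots$ of real numbers; $h_n := t_{n+1}-t_n>0$ are the step sizes and $w_n := h_n/h_{n-1}$ the step size ratios. A $k$-step variable step-size linear multistep method (VLM) for $\dot x(t)=g(x(t))$ is a recurrence $$x_{n+k}+\sum_{j=0}^{k-1}\alpha_{j,n}x_{n+j}=h_{n+k-1}\sum_{j=0}^{k}\beta_{j,n}\,g(x_{n+j}),$$ where $\alpha_{j,n},\beta_{j,n}$ depend on the ratios $w_i$, $i=n+1,\dots,n+k-1$. The VLM is consistent of order $p$ if $$q(t_{n+k})+\sum_{j=0}^{k-1}\alpha_{j,n}q(t_{n+j})=h_{n+k-1}\sum_{j=0}^{k}\beta_{j,n}q'(t_{n+j})$$ holds for all $n\ge 0$, all grids $\{t_i\}$ and all polynomials $q$ of degree $\le p$. In the claim, $k=2$, $\alpha_{1,n}=-(5-3w_{n+1})$, $\alpha_{0,n}=4-3w_{n+1}$, $\beta_{2,n}=0$, $\beta_{1,n}=\frac{w_{n+1}-1}{w_{n+1}}(20-12w_{n+1})$, $\beta_{0,n}=-\frac{w_{n+1}-1}{w_{n+1}}(16-12w_{n+1})$. *)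

(* Defs.v *)
From mathcomp Require Import all_boot all_order all_algebra.
From mathcomp Require Import reals.

Set Implicit Arguments.
Unset Strict Implicit.
Unset Printing Implicit Defensive.

Import Order.TTheory GRing.Theory Num.Theory.
Local Open Scope ring_scope.

Definition is_grid (R : realType) (t : nat -> R) : Prop :=
  forall n : nat, t n < t n.+1.

Definition step (R : realType) (t : nat -> R) (n : nat) : R := t n.+1 - t n.

(* Meaningful for [0 < n] only; no other index is ever used below. *)
Definition step_ratio (R : realType) (t : nat -> R) (n : nat) : R :=
  step t n / step t n.-1.

(* A [k]-step method is given by its coefficients, as functions of the [k - 1]
   step size ratios [w_(n+1), ..., w_(n+k-1)]; the coefficient of [x_(n+k)] is
   normalised to 1. *)
Record vlm (R : realType) (k : nat) := Vlm {
  vlm_alpha : 'I_k -> ('I_k.-1 -> R) -> R ;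
  vlm_beta : 'I_k.+1 -> ('I_k.-1 -> R) -> R
}.

Definition ratios (R : realType) (k : nat) (t : nat -> R) (n : nat) :
    'I_k.-1 -> R :=
  fun i => step_ratio t (n + 1 + i)%N.

Definition alpha_at (R : realType) (k : nat) (M : vlm R k) (t : nat -> R)
    (n : nat) (j : 'I_k) : R :=
  vlm_alpha M j (ratios t n).

Definition beta_at (R : realType) (k : nat) (M : vlm R k) (t : nat -> R)
    (n : nat) (j : 'I_k.+1) : R :=
  vlm_beta M j (ratios t n).

Definition vlm_recurrence (R : realType) (V : lmodType R) (k : nat)
    (M : vlm R k) (g : V -> V) (t : nat -> R) (x : nat -> V) (n : nat) : Prop :=
  x (n + k)%N + \sum_(j < k) alpha_at M t n j *: x (n + j)%N
  = step t (n + k - 1)%N *: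
      \sum_(j < k.+1) beta_at M t n j *: g (x (n + j)%N).

Definition consistent_of_order (R : realType) (k : nat) (M : vlm R k)
    (p : nat) : Prop :=
  forall (n : nat) (t : nat -> R), is_grid t ->
  forall q : {poly R}, (size q <= p.+1)%N ->
    q.[t (n + k)%N] + \sum_(j < k) alpha_at M t n j * q.[t (n + j)%N]
    = step t (n + k - 1)%N *
        \sum_(j < k.+1) beta_at M t n j * q^`().[t (n + j)%N].

Definition two_step_method (R : realType) : vlm R 2 :=
  @Vlm R 2
    (fun j r => let w := r ord0 in
       nth 0 [:: 4 - 3 * w; - (5 - 3 * w)] j)
    (fun j r => let w := r ord0 in
       nth 0 [:: - ((w - 1) / w * (16 - 12 * w));
                 (w - 1) / w * (20 - 12 * w);
                 0] j).

Lemma two_step_methodE (R : realType) (V : lmodType R) (g : V -> V)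
    (t : nat -> R) (x : nat -> V) (n : nat) :
  let w := step_ratio t n.+1 in
  vlm_recurrence (two_step_method R) g t x n <->
  x n.+2 - (5 - 3 * w) *: x n.+1 + (4 - 3 * w) *: x n
  = (step t n.+1 * ((w - 1) / w)) *:
      ((20 - 12 * w) *: g (x n.+1) - (16 - 12 * w) *: g (x n)).
Proof.
rewrite /vlm_recurrence /alpha_at /beta_at !big_ord_recr !big_ord0 /=.
rewrite /ratios /= !add0r !addn0 addn1 addn2 subn1 /= scale0r addr0.
set w := step_ratio t n.+1.
have -> : x n.+2 + ((4 - 3 * w) *: x n + - (5 - 3 * w) *: x n.+1)
  = x n.+2 - (5 - 3 * w) *: x n.+1 + (4 - 3 * w) *: x n.
  by rewrite scaleNr addrA addrAC.
have -> : - ((w - 1) / w * (16 - 12 * w)) *: g (x n)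
    + ((w - 1) / w * (20 - 12 * w)) *: g (x n.+1)
  = ((w - 1) / w) *:
      ((20 - 12 * w) *: g (x n.+1) - (16 - 12 * w) *: g (x n)).
  by rewrite scalerBr !scalerA scaleNr addrC.
by rewrite scalerA.
Qed.

(* Main.v *)
Require Import Defs.
From mathcomp Require Import all_boot all_order all_algebra.
From mathcomp Require Import reals.
From mathcomp Require Import ring.

Import Order.TTheory GRing.Theory Num.Theory.
Local Open Scope ring_scope.

(** By linearity it suffices to test $1$ and $X$. Constants: $1-(5-3w)+(4-3w)=0$, and $q'=0$. For
    $X$, with $h_{n+1}=wh_n$, the left side is $h_{n+1}-(4-3w)h_n=4(w-1)h_n$; on the right the
    $w$-terms of the $\beta$'s cancel, leaving $4h_{n+1}(w-1)/w$, the same value. *)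

Lemma size_le2_polyE (R : nzRingType) (q : {poly R}) :
  (size q <= 2)%N -> q = q`_1 *: 'X + (q`_0)%:P.
Proof.
move=> sq; apply/polyP => -[|[|i]].
- by rewrite coefD coefZ coefX coefC mulr0 add0r.
- by rewrite coefD coefZ coefX coefC mulr1 addr0.
- by rewrite coefD coefZ coefX coefC mulr0 addr0 nth_default // (leq_trans sq).
Qed.

Theorem theorem3p1 (R : realType) :
  consistent_of_order (two_step_method R) 1.
Proof.
move=> n t tG q /size_le2_polyE ->.
set a := q`_1; set b := q`_0.
rewrite /alpha_at /beta_at !big_ord_recr !big_ord0 /=.
rewrite /ratios /step_ratio /step /= !addn0 addn1 addn2 subn1 /=.
rewrite derivD derivZ derivX derivC addr0 !(hornerD, hornerZ, hornerX, hornerC).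
(* Both steps occur as denominators: $h_n$ in $w=h_{n+1}/h_n$, and $h_{n+1}$ through the factor
   $(w-1)/w$. A strictly increasing grid keeps them nonzero. *)
have h0 : t n.+1 - t n != 0 by rewrite subr_eq0 gt_eqF ?tG.
have h1 : t n.+2 - t n.+1 != 0 by rewrite subr_eq0 gt_eqF ?tG.
by field; rewrite h0 h1.
Qed.
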